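(* Let $0<\beta<1$ and $\alpha\ge 1$ be constants. For every minimization problem, every instance $I$ of it, and every solution $\{x_1,\dots,x_k\}$ constructed for $I$ by an $\alpha$-approximate present-biased agent in $k$ steps, the $\alpha$-approximative cost ratio satisfies $$\varrho_\alpha=\frac{\sum_{i=1}^k\omega(x_i)}{\mathrm{opt}(I)}\le \alpha\cdot k .$$
   Context: **Minimization problems.** An instance $I$ consists of a finite nonempty ground set $\mathcal S_I$, a weight function $\omega:\mathcal S_I\to\mathbb N$ (where $\mathbb N=\{1,2,\dots\}$), and a family $F(I)$ of subsets of $\mathcal S_I$, called feasible solutions, that contains $\mathcal S_I$ and is closed upward: $S\in F(I)$ and $S\subseteq S'\subseteq\mathcal S_I$ imply $S'\in F(I)$. The cost of $S$ is $c(S)=\sum_{x\in S}\omega(x)$, and $\mathrm{opt}(I)=\min_{S\in F(I)}c(S)$. For $x\in\mathcal S_I$, $I\smallsetminus\{x\}$ is the instance with ground set $\mathcal S_I\smallsetminus\{x\}$, the same weights, and feasible solutions $S\smallsetminus\{x\}$ for $S\in F(I)$. A minimization problem is a class of such instances closed under $I\mapsto I\smallsetminus\{x\}$. The initial instance $I$ is assumed to satisfy $\emptyset\notin F(I)$, so that $\mathrm{opt}(I)>0$. **Biased cost.** For nonempty $S$, $c_\beta(S)=\omega(x)+\beta\,c(S\smallsetminus\{x\})$, where $x\in\operatorname{argmin}_{y\in S}\omega(y)$. **$\alpha$-approximate present-biased agent.** Put $I_1=I$. At step $i\ge1$, the agent computes some feasible solution $S_i$ of $I_i$ with $c_\beta(S_i)\le\alpha\min_{S\in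 F(I_i)}c_\beta(S)$ and selects some $x_i\in\operatorname{argmin}_{y\in S_i}\omega(y)$. It stops as soon as $\{x_1,\dots,x_i\}\in F(I)$; otherwise it continues with $I_{i+1}=I_i\smallsetminus\{x_i\}$. Choices and ties are otherwise arbitrary. *)

(* Defs.v *)
From mathcomp Require Import all_boot all_order all_algebra.
Set Implicit Arguments.
Unset Strict Implicit.
Unset Printing Implicit Defensive.
Import Order.TTheory GRing.Theory Num.Theory.

Local Open Scope ring_scope.

(* The ground set is a subset of an ambient finite type, so that deleting an
   element does not change the type; values of [weight] outside [ground] carry
   no meaning. *)
Record instance (T : finType) := Instance {
  ground : {set T};
  weight : T -> nat;
  feasible : {set {set T}}
}.

Definition wf_instance (T : finType) (I : instance T) : Prop :=
  [/\ ground I != set0,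
      forall x, x \in ground I -> (0 < weight I x)%N,
      forall S, S \in feasible I -> S \subset ground I,
      ground I \in feasible I
    & forall S S' : {set T}, S \in feasible I -> S \subset S' ->
        S' \subset ground I -> S' \in feasible I].

Definition delete (T : finType) (I : instance T) (x : T) : instance T :=
  Instance (ground I :\ x) (weight I) [set S :\ x | S in feasible I].

(* Closure under deletion is only required when the remaining ground set is
   nonempty, since otherwise the result is not an instance. *)
Record problem := Problem {
  member : forall T : finType, instance T -> Prop;
  member_wf : forall (T : finType) (I : instance T),
    member I -> wf_instance I;
  member_delete : forall (T : finType) (I : instance T) (x : T),
    member I -> x \in ground I -> ground I :\ x != set0 ->
    member (delete I x)
}.

Definition cost (T : finType) (I : instance T) (S : {set T}) : nat :=
  (\sum_(x in S) weight I x)%N.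

(* [ground I] is only the default of [arg min]; it is feasible in every
   well-formed instance. *)
Definition opt (T : finType) (I : instance T) : nat :=
  cost I [arg min_(S < ground I in feasible I) cost I S]%N.

Definition argmin (T : finType) (I : instance T) (S : {set T}) : {set T} :=
  [set x in S | [forall y in S, weight I x <= weight I y]%N].

(* The value 0 on the empty set is a junk value; by [biased_costE] the choice
   made by [pick] is irrelevant. *)
Definition biased_cost (R : realFieldType) (beta : R) (T : finType)
    (I : instance T) (S : {set T}) : R :=
  if [pick x in argmin I S] is Some x
  then (weight I x)%:R + beta * (cost I (S :\ x))%:R else 0.

Lemma biased_costE (R : realFieldType) (beta : R) (T : finType)
    (I : instance T) (S : {set T}) (x : T) :
  x \in argmin I S ->
  biased_cost beta I S = (weight I x)%:R + beta * (cost I (S :\ x))%:R.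
Proof.
rewrite /biased_cost; case: pickP => [y ySm xSm|/(_ x) ->//].
move: ySm xSm; rewrite !inE => /andP[yS /forall_inP ymin].
move=> /andP[xS /forall_inP xmin].
have wxy : weight I y = weight I x.
  by apply/eqP; rewrite eqn_leq ymin // xmin.
suff -> : cost I (S :\ y) = cost I (S :\ x) by rewrite wxy.
apply/eqP; rewrite -(eqn_add2l (weight I y)) {2}wxy.
by rewrite /cost -!big_setD1.
Qed.

Definition biased_opt (R : realFieldType) (beta : R) (T : finType)
    (I : instance T) : R :=
  biased_cost beta I
    [arg min_(S < ground I in feasible I) biased_cost beta I S]%O.

Definition agent_step (R : realFieldType) (alpha beta : R) (T : finType)
    (I : instance T) (x : T) : Prop :=
  exists S : {set T},
    [/\ S \in feasible I,
        biased_cost beta I S <= alpha * biased_opt beta I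
      & x \in argmin I S].

(* [agent_run alpha beta I J X s]: facing the residual instance [J] of the
   initial instance [I] after having selected the elements of [X], the agent
   may select the elements of [s], in this order, and then stop. *)
Inductive agent_run (R : realFieldType) (alpha beta : R) (T : finType)
    (I : instance T) : instance T -> {set T} -> seq T -> Prop :=
| agent_stop (J : instance T) (X : {set T}) (x : T) :
    agent_step alpha beta J x -> x |: X \in feasible I ->
    agent_run alpha beta I J X [:: x]
| agent_continue (J : instance T) (X : {set T}) (x : T) (s : seq T) :
    agent_step alpha beta J x -> x |: X \notin feasible I ->
    agent_run alpha beta I (delete J x) (x |: X) s ->
    agent_run alpha beta I J X (x :: s).

Definition agent_solution (R : realFieldType) (alpha beta : R) (T : finType)
    (I : instance T) (s : seq T) : Prop :=
  agent_run alpha beta I I set0 s.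

Definition cost_ratio (R : realFieldType) (T : finType) (I : instance T)
    (s : seq T) : R :=
  (\sum_(x <- s) (weight I x)%:R) / (opt I)%:R.

(* Main.v *)
(* Fix an optimal solution S of I. Removing from S the elements selected so far
   leaves a feasible solution of every residual instance, so each selected
   element x_i, which weighs at most the biased cost of the agent's solution
   S_i, weighs at most alpha * c_beta(S) <= alpha * c(S) = alpha * opt(I). *)
Require Import Defs.
From mathcomp Require Import all_boot all_order all_algebra.
Set Implicit Arguments.
Unset Strict Implicit.
Unset Printing Implicit Defensive.
Import Order.TTheory GRing.Theory Num.Theory.
Local Open Scope ring_scope.

Lemma argmin_subset (T : finType) (I : instance T) (S : {set T}) :
  argmin I S \subset S.
Proof. by apply/subsetP => x; rewrite inE => /andP[]. Qed.

Lemma cost_setD1_le (T : finType) (I : instance T) (S : {set T}) (x : T) :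
  (cost I (S :\ x) <= cost I S)%N.
Proof. by rewrite /cost (big_setID [set x] (A := S)) leq_addl. Qed.

Lemma weight_le_biased_cost (R : realFieldType) (beta : R) (T : finType)
    (I : instance T) (S : {set T}) (x : T) :
  0 <= beta -> x \in argmin I S -> (weight I x)%:R <= biased_cost beta I S.
Proof. by move=> beta_ge0 /biased_costE ->; rewrite lerDl mulr_ge0. Qed.

Lemma biased_cost_le_cost (R : realFieldType) (beta : R) (T : finType)
    (I : instance T) (S : {set T}) :
  beta <= 1 -> biased_cost beta I S <= (cost I S)%:R.
Proof.
(* If [pick] finds nothing, the biased cost is the junk value 0, so the bound also covers an empty
   [S]; the induction over a run can then shrink a solution without tracking that it stays
   nonempty. *)
move=> beta_le1; rewrite /biased_cost; case: pickP => [x xS|_]; last exact: ler0n.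
have -> : cost I S = (weight I x + cost I (S :\ x))%N.
  by rewrite /cost -big_setD1 // (subsetP (argmin_subset I S)).
by rewrite natrD lerD2l ler_piMl.
Qed.

(** Feasibility of [ground I] makes the default of the [arg min] admissible, so the set it returns
    is a true minimizer. *)
Lemma biased_opt_le (R : realFieldType) (beta : R) (T : finType)
    (I : instance T) (S : {set T}) :
  ground I \in feasible I -> S \in feasible I ->
  biased_opt beta I <= biased_cost beta I S.
Proof. by move=> gI SI; rewrite /biased_opt; case: arg_minP => // S' _; apply. Qed.

Lemma opt_attained (T : finType) (I : instance T) :
  ground I \in feasible I -> exists2 S, S \in feasible I & opt I = cost I S.
Proof. by move=> gI; rewrite /opt; case: arg_minnP => // S SI _; exists S. Qed.

Lemma cost_gt0 (T : finType) (I : instance T) (S : {set T}) :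
  wf_instance I -> S \in feasible I -> S != set0 -> (0 < cost I S)%N.
Proof.
move=> [_ w_gt0 sub_ground _ _] SI /set0Pn[x xS].
rewrite /cost (big_setD1 x) //= addn_gt0 w_gt0 //.
exact: subsetP (sub_ground S SI) x xS.
Qed.

(** [S] is any feasible solution: what remains of an optimal one after deletions need not be optimal
    in the residual instance. *)
Lemma agent_step_weight_le (R : realFieldType) (alpha beta : R) (T : finType)
    (I : instance T) (S : {set T}) (x : T) :
  0 <= beta -> beta <= 1 -> 0 <= alpha ->
  ground I \in feasible I -> S \in feasible I ->
  agent_step alpha beta I x -> (weight I x)%:R <= alpha * (cost I S)%:R.
Proof.
move=> beta_ge0 beta_le1 alpha_ge0 gI SI [S' [_ approxS' xS']].
apply: le_trans (weight_le_biased_cost beta_ge0 xS') _.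
apply: le_trans approxS' _; apply: ler_wpM2l => //.
exact: le_trans (biased_opt_le beta gI SI) (biased_cost_le_cost _ _ beta_le1).
Qed.

(** Induction on the run. [S] is quantified after the run because it shrinks with each deletion. Of
    well-formedness only the feasibility of [ground J] is carried along: it survives deletion even
    when the ground set becomes empty. *)
Lemma agent_run_weight_le (R : realFieldType) (alpha beta : R) (T : finType)
    (I J : instance T) (X : {set T}) (s : seq T) :
  0 <= beta -> beta <= 1 -> 0 <= alpha ->
  agent_run alpha beta I J X s ->
  forall S, ground J \in feasible J -> S \in feasible J ->
  \sum_(x <- s) (weight J x)%:R <= (alpha * (cost J S)%:R) *+ size s.
Proof.
move=> beta_ge0 beta_le1 alpha_ge0.
elim=> {J X s} [J X x Jx _|J X x s Jx _ _ IH] S gJ SJ; rewrite big_cons.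
  rewrite big_nil addr0; exact: agent_step_weight_le SJ Jx.
rewrite mulrS; apply: lerD; first exact: agent_step_weight_le SJ Jx.
(* Both [ground J :\ x] and [S :\ x] are images of feasible sets under the deletion of [x], whether
   or not [x] lies in [S]. Weights are unchanged by [delete], so the sums agree by conversion. *)
apply: le_trans (IH (S :\ x) _ _) _; [exact: imset_f..|].
apply: ler_wMn2r; apply: ler_wpM2l => //.
by rewrite ler_nat cost_setD1_le.
Qed.

Theorem theorem1 (R : realFieldType) (alpha beta : R)
    (beta_gt0 : 0 < beta) (beta_lt1 : beta < 1) (alpha_ge1 : 1 <= alpha)
    (P : problem) (T : finType) (I : instance T) (PI : member P I)
    (set0_infeasible : set0 \notin feasible I)
    (s : seq T) (sP : agent_solution alpha beta I s) :
  cost_ratio R I s <= alpha * (size s)%:R.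
Proof.
have wfI := member_wf PI; have [_ _ _ gI _] := wfI.
have [S SI optS] := opt_attained gI.
have S_neq0 : S != set0 by apply: contraNneq set0_infeasible => <-.
(* The denominator can be cleared because a nonempty solution has positive cost. *)
rewrite /cost_ratio optS ler_pdivrMr ?ltr0n ?cost_gt0 //.
rewrite mulrAC mulr_natr.
apply: (agent_run_weight_le _ _ _ sP gI SI); [exact: ltW..|].
exact: le_trans ler01 alpha_ge1.
Qed.
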